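(* Consider the 2D special relativistic hydrodynamics (RHD) system with a Synge-type equation of state $h=h(\theta)=1+e(\theta)+\theta$, $\theta=p/\rho$, satisfying $e'(\theta)>0$ and $h(\theta)>\theta(1+e'(\theta))/e'(\theta)$ for all $\theta>0$. Let $\Delta_\theta=h-\theta(1+e'(\theta))$, and for $j\in\{1,4\}$ let $\Delta_{\lambda_1^{(j)}}=\frac{1-v_1^2}{1-v_1\lambda_1^{(j)}}$ and $\Delta_{\lambda_2^{(j)}}=\frac{1-v_2^2}{1-v_2\lambda_2^{(j)}}$. Define $$\mathbf R_1:=\begin{pmatrix}1&\frac1\gamma&\gamma v_2&1\\ h\gamma\Delta_{\lambda_1^{(1)}}\lambda_1^{(1)}&\Delta_\theta v_1&2h\gamma^2v_1v_2&h\gamma\Delta_{\lambda_1^{(4)}}\lambda_1^{(4)}\\ h\gamma v_2&\Delta_\theta v_2&h(1+2\gamma^2v_2^2)&h\gamma v_2\\ h\gamma\Delta_{\lambda_1^{(1)}}&\Delta_\theta&2h\gamma^2v_2&h\gamma\Delta_{\lambda_1^{(4)}}\end{pmatrix}\mathrm{diag}\left\{\sqrt{d_1^{(1)}},\sqrt{d_1^{(2)}},\sqrt{d_1^{(3)}},\sqrt{d_1^{(4)}}\right\}$$ with $$d_1^{(1)}=\frac{M_1-N_1}{2},\quad d_1^{(2)}=\frac{\rho\gamma^3}{1+e'(\theta)},\quad d_1^{(3)}=\frac{\rho\theta}{h(1-v_1^2)\gamma},\quad d_1^{(4)}=\frac{M_1+N_1}{2},$$ $$M_1=\rho\gamma\left(\frac{e'(\theta)}{1+e'(\theta)}-\frac{\theta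 v_2^2}{h(1-v_1^2)}\right),\qquad N_1=\frac{\rho\theta v_1\sqrt{1-v_1^2-v_2^2c_s^2}}{hc_s(1-v_1^2)},$$ and $$\mathbf R_2:=\begin{pmatrix}1&\gamma v_1&\frac1\gamma&1\\ h\gamma v_1&h(1+2\gamma^2v_1^2)&\Delta_\theta v_1&h\gamma v_1\\ h\gamma\Delta_{\lambda_2^{(1)}}\lambda_2^{(1)}&2h\gamma^2v_1v_2&\Delta_\theta v_2&h\gamma\Delta_{\lambda_2^{(4)}}\lambda_2^{(4)}\\ h\gamma\Delta_{\lambda_2^{(1)}}&2h\gamma^2v_1&\Delta_\theta&h\gamma\Delta_{\lambda_2^{(4)}}\end{pmatrix}\mathrm{diag}\left\{\sqrt{d_2^{(1)}},\sqrt{d_2^{(2)}},\sqrt{d_2^{(3)}},\sqrt{d_2^{(4)}}\right\}$$ with $$d_2^{(1)}=\frac{M_2-N_2}{2},\quad d_2^{(2)}=\frac{\rho\theta}{h(1-v_2^2)\gamma},\quad d_2^{(3)}=\frac{\rho\gamma^3}{1+e'(\theta)},\quad d_2^{(4)}=\frac{M_2+N_2}{2},$$ $$M_2=\rho\gamma\left(\frac{e'(\theta)}{1+e'(\theta)}-\frac{\theta v_1^2}{h(1-v_2^2)}\right),\qquad N_2=\frac{\rho\theta v_2\sqrt{1-v_2^2-v_1^2c_s^2}}{hc_s(1-v_2^2)} .$$ Then, for $k=1,2$, $$\frac{\partial\mathbf F_k}{\partial\mathbf U}=\mathbf R_k\boldsymbol\Lambda_k\mathbf R_k^{-1},\qquad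 \frac{\partial\mathbf U}{\partial\mathbf W}=\mathbf R_k\mathbf R_k^\top,$$ where $\boldsymbol\Lambda_k=\mathrm{diag}\{\lambda_k^{(1)},\lambda_k^{(2)},\lambda_k^{(3)},\lambda_k^{(4)}\}$.
   Context: The 2D RHD system is $\partial_t\mathbf U+\partial_{x_1}\mathbf F_1(\mathbf U)+\partial_{x_2}\mathbf F_2(\mathbf U)=\mathbf 0$ with $\mathbf U=(D,m_1,m_2,E)^\top$, $\mathbf F_1=(Dv_1,\ v_1m_1+p,\ v_1m_2,\ m_1)^\top$, $\mathbf F_2=(Dv_2,\ v_2m_1,\ v_2m_2+p,\ m_2)^\top$, $D=\rho\gamma$, $m_k=\rho h\gamma^2v_k$, $E=\rho h\gamma^2-p$, where $\rho>0$, $p>0$, $v_1^2+v_2^2<1$, $\gamma=(1-v_1^2-v_2^2)^{-1/2}$, $\theta=p/\rho$; $e$ is continuously differentiable on $(0,\infty)$. The sound speed $c_s\in(0,1)$ is given by $c_s^2=\frac{\theta(1+e'(\theta))}{h\,e'(\theta)}$. With $S=-\ln\rho+\int^\theta\frac{e'(x)}{x}dx$ (a fixed antiderivative of $e'(\theta)/\theta$), the entropy variables (gradient with respect to $\mathbf U$ of the entropy $\eta=-DS$) are $\mathbf W=\frac1\theta(h-\theta S,\gamma v_1,\gamma v_2,-\gamma)^\top$. The eigenvalues are: $\lambda_1^{(2)}=\lambda_1^{(3)}=v_1$, $\lambda_2^{(2)}=\lambda_2^{(3)}=v_2$, and (with the sign $-$ for the superscript $(1)$ and $+$ for $(4)$)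 $$\lambda_1^{(1)},\lambda_1^{(4)}=\frac{v_1(1-c_s^2)\mp c_s\sqrt{(1-v_1^2-v_2^2)(1-v_1^2-v_2^2c_s^2)}}{1-(v_1^2+v_2^2)c_s^2},\qquad \lambda_2^{(1)},\lambda_2^{(4)}=\frac{v_2(1-c_s^2)\mp c_s\sqrt{(1-v_1^2-v_2^2)(1-v_2^2-v_1^2c_s^2)}}{1-(v_1^2+v_2^2)c_s^2}.$$ Derivatives with respect to $\mathbf U$ and $\mathbf W$ are understood through the changes of variables with $\mathbf V=(\rho,v_1,v_2,p)^\top$: $\frac{\partial\mathbf F_k}{\partial\mathbf U}=\frac{\partial\mathbf F_k}{\partial\mathbf V}\left(\frac{\partial\mathbf U}{\partial\mathbf V}\right)^{-1}$ and $\frac{\partial\mathbf U}{\partial\mathbf W}=\frac{\partial\mathbf U}{\partial\mathbf V}\left(\frac{\partial\mathbf W}{\partial\mathbf V}\right)^{-1}$. *)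

(* Defs.v *)
(* Two-dimensional special relativistic hydrodynamics over an arbitrary
   [R : realType]. *)
From mathcomp Require Import all_boot all_order all_algebra.
From mathcomp Require Import all_classical all_reals all_analysis.

Set Implicit Arguments.
Unset Strict Implicit.
Unset Printing Implicit Defensive.

Import Order.TTheory GRing.Theory Num.Theory.
Import numFieldNormedType.Exports.

Local Open Scope classical_set_scope.
Local Open Scope ring_scope.

(* States are row vectors because the library's jacobian ['J f V] is defined on
   row vectors. Its entry (j, i) is the partial derivative of f_i with respect
   to V_j, so the usual (column-vector) Jacobian matrix is its transpose. *)
Definition jac (R : realType) (f : 'rV[R]_4 -> 'rV[R]_4) (V : 'rV[R]_4) :
  'M[R]_4 := ('J f V)^T.

Definition row4 (R : realType) (a b c d : R) : 'rV[R]_4 :=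
  \row_(j < 4) [:: a; b; c; d]`_j.

Definition mat4 (R : realType) (rows : seq (seq R)) : 'M[R]_4 :=
  \matrix_(i < 4, j < 4) (nth [::] rows i)`_j.

(* Primitive variables V = (rho, v1, v2, p). *)
Definition rho (R : realType) (V : 'rV[R]_4) : R := V 0 0.
Definition vel1 (R : realType) (V : 'rV[R]_4) : R := V 0 1.
Definition vel2 (R : realType) (V : 'rV[R]_4) : R := V 0 2.
Definition pres (R : realType) (V : 'rV[R]_4) : R := V 0 3.

Definition admissible (R : realType) (V : 'rV[R]_4) : Prop :=
  [/\ 0 < rho V, 0 < pres V & vel1 V ^+ 2 + vel2 V ^+ 2 < 1].

Definition theta (R : realType) (V : 'rV[R]_4) : R := pres V / rho V.

Definition lorentz (R : realType) (V : 'rV[R]_4) : R :=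
  (Num.sqrt (1 - vel1 V ^+ 2 - vel2 V ^+ 2))^-1.

(* The equation of state is given by [e], as a function of theta; only its
   values on (0, +oo) are relevant. *)
Definition enthalpy (R : realType) (e : R -> R) (x : R) : R := 1 + e x + x.

Definition consU (R : realType) (e : R -> R) (V : 'rV[R]_4) : 'rV[R]_4 :=
  let h := enthalpy e (theta V) in
  let g := lorentz V in
  row4 (rho V * g)
       (rho V * h * g ^+ 2 * vel1 V)
       (rho V * h * g ^+ 2 * vel2 V)
       (rho V * h * g ^+ 2 - pres V).

Definition fluxF1 (R : realType) (e : R -> R) (V : 'rV[R]_4) : 'rV[R]_4 :=
  let U := consU e V in
  let D := U 0 0 in let m1 := U 0 1 in let m2 := U 0 2 in
  row4 (D * vel1 V) (vel1 V * m1 + pres V) (vel1 V * m2) m1.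

Definition fluxF2 (R : realType) (e : R -> R) (V : 'rV[R]_4) : 'rV[R]_4 :=
  let U := consU e V in
  let D := U 0 0 in let m1 := U 0 1 in let m2 := U 0 2 in
  row4 (D * vel2 V) (vel2 V * m1) (vel2 V * m2 + pres V) m2.

(* [Z] stands for an antiderivative of e'(x) / x on (0, +oo). *)
Definition entropyS (R : realType) (Z : R -> R) (V : 'rV[R]_4) : R :=
  - ln (rho V) + Z (theta V).

Definition entropyW (R : realType) (e Z : R -> R) (V : 'rV[R]_4) : 'rV[R]_4 :=
  let g := lorentz V in
  (theta V)^-1 *: row4 (enthalpy e (theta V) - theta V * entropyS Z V)
                       (g * vel1 V) (g * vel2 V) (- g).

Definition dF1dU (R : realType) (e : R -> R) (V : 'rV[R]_4) : 'M[R]_4 :=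
  jac (fluxF1 e) V *m invmx (jac (consU e) V).

Definition dF2dU (R : realType) (e : R -> R) (V : 'rV[R]_4) : 'M[R]_4 :=
  jac (fluxF2 e) V *m invmx (jac (consU e) V).

Definition dUdW (R : realType) (e Z : R -> R) (V : 'rV[R]_4) : 'M[R]_4 :=
  jac (consU e) V *m invmx (jac (entropyW e Z) V).

Definition sound (R : realType) (e : R -> R) (V : 'rV[R]_4) : R :=
  let t := theta V in
  Num.sqrt (t * (1 + derive1 e t) / (enthalpy e t * derive1 e t)).

(* The acoustic eigenvalues: s = -1 gives superscript (1), s = 1 gives (4). *)
Definition acoustic1 (R : realType) (e : R -> R) (V : 'rV[R]_4) (s : R) : R :=
  let v1 := vel1 V in let v2 := vel2 V in let c := sound e V in
  (v1 * (1 - c ^+ 2)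
   + s * (c * Num.sqrt ((1 - v1 ^+ 2 - v2 ^+ 2)
                        * (1 - v1 ^+ 2 - v2 ^+ 2 * c ^+ 2))))
  / (1 - (v1 ^+ 2 + v2 ^+ 2) * c ^+ 2).

Definition acoustic2 (R : realType) (e : R -> R) (V : 'rV[R]_4) (s : R) : R :=
  let v1 := vel1 V in let v2 := vel2 V in let c := sound e V in
  (v2 * (1 - c ^+ 2)
   + s * (c * Num.sqrt ((1 - v1 ^+ 2 - v2 ^+ 2)
                        * (1 - v2 ^+ 2 - v1 ^+ 2 * c ^+ 2))))
  / (1 - (v1 ^+ 2 + v2 ^+ 2) * c ^+ 2).

Definition Lambda1 (R : realType) (e : R -> R) (V : 'rV[R]_4) : 'M[R]_4 :=
  diag_mx (row4 (acoustic1 e V (-1)) (vel1 V) (vel1 V) (acoustic1 e V 1)).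

Definition Lambda2 (R : realType) (e : R -> R) (V : 'rV[R]_4) : 'M[R]_4 :=
  diag_mx (row4 (acoustic2 e V (-1)) (vel2 V) (vel2 V) (acoustic2 e V 1)).

Definition Delta_theta (R : realType) (e : R -> R) (V : 'rV[R]_4) : R :=
  let t := theta V in enthalpy e t - t * (1 + derive1 e t).

Definition Delta_lambda (R : realType) (v l : R) : R :=
  (1 - v ^+ 2) / (1 - v * l).

Definition M1 (R : realType) (e : R -> R) (V : 'rV[R]_4) : R :=
  let t := theta V in let h := enthalpy e t in
  rho V * lorentz V * (derive1 e t / (1 + derive1 e t)
                       - t * vel2 V ^+ 2 / (h * (1 - vel1 V ^+ 2))).

Definition N1 (R : realType) (e : R -> R) (V : 'rV[R]_4) : R :=
  let t := theta V in let h := enthalpy e t in let c := sound e V in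
  rho V * t * vel1 V * Num.sqrt (1 - vel1 V ^+ 2 - vel2 V ^+ 2 * c ^+ 2)
  / (h * c * (1 - vel1 V ^+ 2)).

Definition M2 (R : realType) (e : R -> R) (V : 'rV[R]_4) : R :=
  let t := theta V in let h := enthalpy e t in
  rho V * lorentz V * (derive1 e t / (1 + derive1 e t)
                       - t * vel1 V ^+ 2 / (h * (1 - vel2 V ^+ 2))).

Definition N2 (R : realType) (e : R -> R) (V : 'rV[R]_4) : R :=
  let t := theta V in let h := enthalpy e t in let c := sound e V in
  rho V * t * vel2 V * Num.sqrt (1 - vel2 V ^+ 2 - vel1 V ^+ 2 * c ^+ 2)
  / (h * c * (1 - vel2 V ^+ 2)).

Definition d1 (R : realType) (e : R -> R) (V : 'rV[R]_4) : 'rV[R]_4 :=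
  let t := theta V in let h := enthalpy e t in let g := lorentz V in
  row4 ((M1 e V - N1 e V) / 2)
       (rho V * g ^+ 3 / (1 + derive1 e t))
       (rho V * t / (h * (1 - vel1 V ^+ 2) * g))
       ((M1 e V + N1 e V) / 2).

Definition d2 (R : realType) (e : R -> R) (V : 'rV[R]_4) : 'rV[R]_4 :=
  let t := theta V in let h := enthalpy e t in let g := lorentz V in
  row4 ((M2 e V - N2 e V) / 2)
       (rho V * t / (h * (1 - vel2 V ^+ 2) * g))
       (rho V * g ^+ 3 / (1 + derive1 e t))
       ((M2 e V + N2 e V) / 2).

Definition R1 (R : realType) (e : R -> R) (V : 'rV[R]_4) : 'M[R]_4 :=
  let v1 := vel1 V in let v2 := vel2 V in
  let h := enthalpy e (theta V) in let g := lorentz V in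
  let Dt := Delta_theta e V in
  let lm := acoustic1 e V (-1) in let lp := acoustic1 e V 1 in
  let Dm := Delta_lambda v1 lm in let Dp := Delta_lambda v1 lp in
  mat4 [:: [:: 1;               g^-1;    g * v2;                          1];
           [:: h * g * Dm * lm; Dt * v1; 2 * h * g ^+ 2 * v1 * v2;        h * g * Dp * lp];
           [:: h * g * v2;      Dt * v2; h * (1 + 2 * g ^+ 2 * v2 ^+ 2);  h * g * v2];
           [:: h * g * Dm;      Dt;      2 * h * g ^+ 2 * v2;             h * g * Dp]]
  *m diag_mx (map_mx Num.sqrt (d1 e V)).

Definition R2 (R : realType) (e : R -> R) (V : 'rV[R]_4) : 'M[R]_4 :=
  let v1 := vel1 V in let v2 := vel2 V in
  let h := enthalpy e (theta V) in let g := lorentz V in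
  let Dt := Delta_theta e V in
  let lm := acoustic2 e V (-1) in let lp := acoustic2 e V 1 in
  let Dm := Delta_lambda v2 lm in let Dp := Delta_lambda v2 lp in
  mat4 [:: [:: 1;               g * v1;                         g^-1;    1];
           [:: h * g * v1;      h * (1 + 2 * g ^+ 2 * v1 ^+ 2); Dt * v1; h * g * v1];
           [:: h * g * Dm * lm; 2 * h * g ^+ 2 * v1 * v2;       Dt * v2; h * g * Dp * lp];
           [:: h * g * Dm;      2 * h * g ^+ 2 * v1;            Dt;      h * g * Dp]]
  *m diag_mx (map_mx Num.sqrt (d2 e V)).

(* Main.v *)
Require Import Defs.
From mathcomp Require Import all_boot all_order all_algebra.
From mathcomp Require Import all_classical all_reals all_analysis.
From mathcomp Require Import perm ring lra.
Import Order.TTheory GRing.Theory Num.Theory.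
Import numFieldNormedType.Exports.
Local Open Scope classical_set_scope.
Local Open Scope ring_scope.

Set Implicit Arguments.
Unset Strict Implicit.
Unset Printing Implicit Defensive.

(** The columns of [R1] are images of explicit perturbations of the primitive
    variables, and everything follows from pairing these perturbations with the
    entropy variables; no Jacobian is ever inverted explicitly.

    Let A, J, W be the Jacobian matrices of U, F_1 and the entropy variables
    with respect to the primitive variables V. It is enough to find a matrix Y of
    primitive perturbations with A Y = R, J Y = R Lambda and R^T (W Y) = 1
    ([symmetrized_diagonalization]): the last identity makes R, W and Y
    invertible, the first one then makes A invertible, J A^-1 = R Lambda R^-1
    follows from the first two, and A W^-1 = (A Y) (W Y)^-1 = R R^T.

    Up to scaling, the columns of Y are an entropy wave (only rho varies), a
    shear wave (only v2 varies) and two acoustic waves. The acoustic ones look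
    simple once seen in a frame that moves along the first axis with velocity
    v1. The fluid has no longitudinal velocity there, so that the acoustic
    fronts move with opposite velocities k and -k, where
        k = c sqrt(1 - v1^2 - v2^2) / sqrt(1 - v1^2 - v2^2 c^2).
    In the original frame their speeds are the relativistic sums
    (v1 + kap) / (1 + v1 kap) with kap = k or -k ([acoustic1E]). In terms of kap
    the square roots disappear: Delta_lambda = 1 + v1 kap,
    Delta_lambda lambda = v1 + kap, N_1 = M_1 v1 k, and the acoustic weights
    M_1 (1 + v1 kap) / 2 are visibly positive. The acoustic identities use the
    equation of state through the sound speed only ([wave_speed_eos]). What
    remains is a finite list of rational identities in rho, theta, v1, v2, h, e'
    and kap, modulo that relation and 1 / gamma^2 = 1 - v1^2 - v2^2. They say
    that A and J map the unscaled columns y_j of Y as required, and that the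
    pairings r_i . W y_j with the unscaled columns r_i of R vanish for distinct
    i, j and are the inverses of the weights d_1 for i = j.

    The second direction is the first one after exchanging the two axes. The
    exchange acts on states by a permutation matrix P, the conserved and entropy
    variables are equivariant under it, and it conjugates F_1 to F_2; so all
    matrices at V are conjugates by P of those of the first direction at the
    exchanged state. *)

(** * Differentials of maps between row vectors *)

Lemma is_diff_comp1 (R : realType) (V : normedModType R) (f df : V -> R)
  (phi : R -> R) (l : R) (x : V) :
  is_diff x f df -> is_derive (f x) 1 phi l ->
  is_diff x (fun y => phi (f y)) (fun h => l * df h).
Proof.
move=> dfx dphi; have [phi_der phiE] := dphi.
have dphix : is_diff (f x) phi (fun y => y *: l).
  apply: DiffDef; first exact/derivable1_diffP.
  rewrite diff1E; last exact/derivable1_diffP.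
  by rewrite derive1E phiE.
apply: (is_diff_eq (is_diff_comp dfx dphix)).
by apply/funext => h /=; rewrite -[LHS]/(df h * l) mulrC.
Qed.

Lemma is_diff_coord (R : realType) n (V : 'rV[R]_n) (j : 'I_n) :
  is_diff V (fun W => W 0 j) (fun h => h 0 j).
Proof.
have @f : {linear 'rV[R]_n -> R}.
  by exists (fun N : 'rV[R]_n => N 0 j); do 2![eexists]; do ?[constructor];
     rewrite ?mxE// => ? *; rewrite ?mxE//; move=> ?; rewrite !mxE.
have -> : (fun W : 'rV[R]_n => W 0 j) = f by [].
apply: DiffDef; first exact/linear_differentiable/coord_continuous.
by rewrite diff_lin//; exact: coord_continuous.
Qed.

Lemma row4E (R : realType) (a b c d : R) :
  (row4 a b c d 0 0 = a) * (row4 a b c d 0 1 = b)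
  * (row4 a b c d 0 2 = c) * (row4 a b c d 0 3 = d).
Proof. by do !split; rewrite mxE. Qed.

Lemma row4_eta (R : realType) (u : 'rV[R]_4) :
  u = row4 (u 0 0) (u 0 1) (u 0 2) (u 0 3).
Proof.
apply/rowP => -[[|[|[|[|//]]]] lt_j4]; rewrite !mxE /=; congr (u _ _);
  exact/val_inj.
Qed.

Lemma row4_delta (R : realType) (a b c d : R) :
  row4 a b c d = a *: delta_mx 0 0 + b *: delta_mx 0 1
                 + c *: delta_mx 0 2 + d *: delta_mx 0 3.
Proof.
apply/rowP => -[[|[|[|[|//]]]] lt_j4]; rewrite !mxE /=;
  by rewrite ?mulr1 ?mulr0 ?addr0 ?add0r.
Qed.

Lemma is_diff_row4 (R : realType) (V : normedModType R)
  (a b c d da db dc dd : V -> R) (x : V) :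
  is_diff x a da -> is_diff x b db -> is_diff x c dc -> is_diff x d dd ->
  is_diff x (fun y => row4 (a y) (b y) (c y) (d y))
    (fun h => row4 (da h) (db h) (dc h) (dd h)).
Proof.
move=> ha hb hc hd.
have scale (f df : V -> R) (u : 'rV[R]_4) : is_diff x f df ->
    is_diff x (fun y => f y *: u) (fun h => df h *: u).
  by move=> hf; apply: (@is_diff_comp _ _ _ _ f df ( *:%R ^~ u)).
have := is_diffD (is_diffD (is_diffD (scale a da (delta_mx 0 0) ha)
  (scale b db (delta_mx 0 1) hb)) (scale c dc (delta_mx 0 2) hc))
  (scale d dd (delta_mx 0 3) hd).
by congr (is_diff_def _ _ _); apply/funext => y; rewrite row4_delta.
Qed.

(** Turns products with a Jacobian matrix into values of a differential; the
    directions are the rows of [Y] because [jac] transposes the matrix that acts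
    on row vectors. *)
Lemma mul_tr_jac (R : realType) m (f df : 'rV[R]_4 -> 'rV[R]_4) (V : 'rV[R]_4)
    (Y : 'M[R]_(m, 4)) :
  is_diff V f df -> Y *m (jac f V)^T = \matrix_i df (row i Y).
Proof.
move=> [_ dfE]; rewrite trmxK; apply/row_matrixP => i.
by rewrite row_mul mul_rV_lin1 rowK dfE.
Qed.

(** * The exchange of the two spatial axes *)

(** The same permutation acts on primitive states, where it exchanges the
    velocities, and on conserved states, where it exchanges the momenta. *)
Definition swap (R : realType) (V : 'rV[R]_4) : 'rV[R]_4 :=
  row4 (V 0 0) (V 0 2) (V 0 1) (V 0 3).

Definition swapM (R : realType) : 'M[R]_4 := tperm_mx 1 2.

Lemma swapE (R : realType) (V : 'rV[R]_4) : swap V = V *m swapM R.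
Proof.
rewrite -xcolE; apply/rowP => -[[|[|[|[|//]]]] lt_j4]; rewrite !mxE /=;
  by rewrite permE /=; congr (V _ _); exact/val_inj.
Qed.

Lemma swapM_invol (R : realType) : swapM R *m swapM R = 1%:M.
Proof. by rewrite -perm_mxM tperm2 perm_mx1. Qed.

Lemma tr_swapM (R : realType) : (swapM R)^T = swapM R.
Proof. by rewrite tr_perm_mx tpermV. Qed.

Lemma is_diff_swap (R : realType) (V : 'rV[R]_4) :
  is_diff V (@swap R) (@swap R).
Proof. by apply: is_diff_row4; exact: is_diff_coord. Qed.

(** What transports the first direction to the second: the exchange conjugates
    U and the entropy variables to themselves, and F_1 to F_2. *)
Lemma jac_swap (R : realType) (f g : 'rV[R]_4 -> 'rV[R]_4) (V : 'rV[R]_4) :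
  (forall x, g x = swap (f (swap x))) -> differentiable f (swap V) ->
  jac g V = swapM R *m jac f (swap V) *m swapM R.
Proof.
move=> gE df.
have -> : g = @swap R \o (f \o @swap R) by apply/funext => x; rewrite gE.
have dg : is_diff V (@swap R \o (f \o @swap R))
    (@swap R \o ('d f (swap V) \o @swap R)).
  apply: is_diff_comp; last exact: is_diff_swap.
  by apply: is_diff_comp; [exact: is_diff_swap|exact: differentiableP].
apply/trmx_inj; rewrite !trmx_mul tr_swapM -[LHS]mul1mx (mul_tr_jac _ dg).
apply/row_matrixP => i; rewrite rowK /= !swapE mulmxA row_mul.
rewrite [in RHS]row_mul trmxK mul_rV_lin1; congr ('d _ _ _ *m _).
by rewrite -row_mul mul1mx.
Qed.

(** * Rules of differentiation for scalar functions *)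

Section ScalarDifferentials.
Context {R : realType} {U : normedModType R}.
Implicit Types (f g df dg : U -> R) (x : U).

Lemma is_diff_add f df g dg x : is_diff x f df -> is_diff x g dg ->
  is_diff x (fun y => f y + g y) (fun h => df h + dg h).
Proof. exact: is_diffD. Qed.

Lemma is_diff_opp f df x : is_diff x f df ->
  is_diff x (fun y => - f y) (fun h => - df h).
Proof. exact: is_diffN. Qed.

Lemma is_diff_mul f df g dg x : is_diff x f df -> is_diff x g dg ->
  is_diff x (fun y => f y * g y) (fun h => f x * dg h + g x * df h).
Proof. exact: is_diffM. Qed.

Lemma is_diff_const (a : R) x : is_diff x (fun=> a) (fun=> 0).
Proof. exact: is_diff_cst. Qed.

Lemma is_diff_sqr f df x : is_diff x f df ->
  is_diff x (fun y => f y ^+ 2) (fun h => 2 * f x * df h).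
Proof.
move=> hf; apply: (is_diff_eq (is_diff_mul hf hf)).
by apply/funext => h; ring.
Qed.

Lemma is_diff_inv f df x : is_diff x f df -> f x != 0 ->
  is_diff x (fun y => (f y)^-1) (fun h => - (f x ^- 2) * df h).
Proof.
move=> hf fx0; have dinv : is_derive (f x) 1 (fun y : R => y^-1) (- f x ^- 2).
  have := is_deriveV (f := @id R) fx0 (is_derive_id (f x) 1).
  by rewrite /GRing.scale /= mulr1.
exact: (is_diff_comp1 hf dinv).
Qed.

End ScalarDifferentials.
Arguments is_diff_const {R U} a x.

(** * Differentials of the conserved variables, flux and entropy variables *)

Section PrimitiveDifferentials.
Context {R : realType}.
Variable V : 'rV[R]_4.
Hypothesis V_adm : admissible V.
Implicit Types h : 'rV[R]_4.

Lemma is_diff_rho : is_diff V (@rho R) (@rho R).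
Proof. exact: is_diff_coord. Qed.

Lemma is_diff_vel1 : is_diff V (@vel1 R) (@vel1 R).
Proof. exact: is_diff_coord. Qed.

Lemma is_diff_vel2 : is_diff V (@vel2 R) (@vel2 R).
Proof. exact: is_diff_coord. Qed.

Lemma is_diff_pres : is_diff V (@pres R) (@pres R).
Proof. exact: is_diff_coord. Qed.

Lemma theta_gt0 : 0 < theta V.
Proof. by case: V_adm => ? ? _; rewrite divr_gt0. Qed.

Lemma lorentz_arg_gt0 : 0 < 1 - vel1 V ^+ 2 - vel2 V ^+ 2.
Proof. by case: V_adm => _ _; lra. Qed.

Definition dtheta h : R := (pres h - theta V * rho h) / rho V.

Lemma is_diff_theta : is_diff V (@theta R) dtheta.
Proof.
have [/gt_eqF/negbT rho0 _ _] := V_adm.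
apply: (is_diff_eq (is_diff_mul is_diff_pres (is_diff_inv is_diff_rho rho0))).
by apply/funext => h; rewrite /dtheta /theta; field.
Qed.

Definition dlorentz h : R :=
  lorentz V ^+ 3 * (vel1 V * vel1 h + vel2 V * vel2 h).

Lemma is_diff_lorentz : is_diff V (@lorentz R) dlorentz.
Proof.
have w2_gt0 := lorentz_arg_gt0.
have dw := is_diff_comp1 (is_diff_add (is_diff_add (is_diff_const 1 V)
    (is_diff_opp (is_diff_sqr is_diff_vel1)))
    (is_diff_opp (is_diff_sqr is_diff_vel2))) (is_derive1_sqrt w2_gt0).
have w0 : Num.sqrt (1 - vel1 V ^+ 2 - vel2 V ^+ 2) != 0.
  by rewrite gt_eqF// sqrtr_gt0.
apply: (is_diff_eq (is_diff_inv dw w0)).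
by apply/funext => h; rewrite /dlorentz /lorentz; field.
Qed.

Variables e Z : R -> R.
Hypothesis e_derivable : derivable e (theta V) 1.
Hypothesis Z_derive : is_derive (theta V) 1 Z (derive1 e (theta V) / theta V).

Let a := derive1 e (theta V).
Let H := enthalpy e (theta V).
Let g := lorentz V.

Lemma is_diff_enthalpy :
  is_diff V (fun W => enthalpy e (theta W)) (fun h => (1 + a) * dtheta h).
Proof.
have de : is_derive (theta V) 1 e a.
  by rewrite /a derive1E; exact/derivableP.
apply: (is_diff_eq (is_diff_add (is_diff_add (is_diff_const 1 V)
  (is_diff_comp1 is_diff_theta de)) is_diff_theta)).
by apply/funext => h; ring.
Qed.

(** Differential of rho h gamma^2. *)
Definition denth h : R :=
  (Delta_theta e V * rho h + (1 + a) * pres h) * g ^+ 2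
  + 2 * rho V * H * g * dlorentz h.

Lemma is_diff_enth :
  is_diff V (fun W => rho W * enthalpy e (theta W) * lorentz W ^+ 2) denth.
Proof.
have [/gt_eqF/negbT rho0 _ _] := V_adm.
apply: (is_diff_eq (is_diff_mul (is_diff_mul is_diff_rho is_diff_enthalpy)
  (is_diff_sqr is_diff_lorentz))).
apply/funext => h; rewrite /denth /Delta_theta /dtheta -/H -/g -/a.
by field.
Qed.

Definition dconsU h : 'rV[R]_4 :=
  let E := rho V * H * g ^+ 2 in
  row4 (rho V * dlorentz h + g * rho h)
       (E * vel1 h + vel1 V * denth h)
       (E * vel2 h + vel2 V * denth h)
       (denth h - pres h).

Lemma is_diff_consU : is_diff V (consU e) dconsU.
Proof.
apply: is_diff_row4.
- exact: is_diff_mul is_diff_rho is_diff_lorentz.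
- exact: is_diff_mul is_diff_enth is_diff_vel1.
- exact: is_diff_mul is_diff_enth is_diff_vel2.
- exact: is_diff_add is_diff_enth (is_diff_opp is_diff_pres).
Qed.

(** The flux is a function of U, the velocity and the pressure, so its
    differential is written with that of U: along an eigendirection, [dconsU]
    is then replaced by a column of [R1]. *)
Definition dfluxF1 h : 'rV[R]_4 :=
  let U := consU e V in let dU := dconsU h in
  row4 (U 0 0 * vel1 h + vel1 V * dU 0 0)
       (vel1 V * dU 0 1 + U 0 1 * vel1 h + pres h)
       (vel1 V * dU 0 2 + U 0 2 * vel1 h)
       (dU 0 1).

Lemma is_diff_fluxF1 : is_diff V (fluxF1 e) dfluxF1.
Proof.
have dU j : is_diff V (fun W => consU e W 0 j) (fun h => dconsU h 0 j).
  exact: is_diff_comp is_diff_consU (is_diff_coord _ _).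
(* The last component is found by instance resolution from [dU]. *)
apply: is_diff_row4.
- exact: is_diff_mul (dU 0) is_diff_vel1.
- exact: is_diff_add (is_diff_mul is_diff_vel1 (dU 1)) is_diff_pres.
- exact: is_diff_mul is_diff_vel1 (dU 2).
Qed.

(** In the first component the antiderivative [Z] has disappeared: by
    d(h / theta - S) = dh / theta - h dtheta / theta^2 + drho / rho
    - (e' / theta) dtheta, and dh = (1 + e') dtheta, the e' terms cancel. *)
Definition dentropyW h : 'rV[R]_4 :=
  let t := theta V in
  row4 (((t - H) / t ^+ 2 * pres h + H / t * rho h) / rho V)
       (t^-1 * (g * vel1 h + vel1 V * dlorentz h)
        - t ^- 2 * dtheta h * (g * vel1 V))
       (t^-1 * (g * vel2 h + vel2 V * dlorentz h)
        - t ^- 2 * dtheta h * (g * vel2 V))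
       (t ^- 2 * dtheta h * g - t^-1 * dlorentz h).

Lemma is_diff_entropyW : is_diff V (entropyW e Z) dentropyW.
Proof.
have [rho_gt0 _ _] := V_adm; have t_gt0 := theta_gt0.
have /negbT rho0 := gt_eqF rho_gt0; have /negbT t0 := gt_eqF t_gt0.
have dbeta := is_diff_inv is_diff_theta t0.
have dS := is_diff_add
  (is_diff_opp (is_diff_comp1 is_diff_rho (is_derive1_ln rho_gt0)))
  (is_diff_comp1 is_diff_theta Z_derive).
have -> : entropyW e Z = (fun W => row4
    ((theta W)^-1 * (enthalpy e (theta W) - theta W * entropyS Z W))
    ((theta W)^-1 * (lorentz W * vel1 W)) ((theta W)^-1 * (lorentz W * vel2 W))
    ((theta W)^-1 * - lorentz W)).
  apply/funext => W; apply/rowP => -[[|[|[|[|//]]]] lt_j4]; by rewrite !mxE.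
apply: is_diff_row4.
- apply: (is_diff_eq (is_diff_mul dbeta (is_diff_add is_diff_enthalpy
    (is_diff_opp (is_diff_mul is_diff_theta dS))))).
  apply/funext => h; rewrite /dtheta /entropyS -/a -/H; field.
  by rewrite rho0 t0.
- apply: (is_diff_eq (is_diff_mul dbeta
    (is_diff_mul is_diff_lorentz is_diff_vel1))).
  by apply/funext => h; rewrite -/g; ring.
- apply: (is_diff_eq (is_diff_mul dbeta
    (is_diff_mul is_diff_lorentz is_diff_vel2))).
  by apply/funext => h; rewrite -/g; ring.
- apply: (is_diff_eq (is_diff_mul dbeta (is_diff_opp is_diff_lorentz))).
  by apply/funext => h; rewrite -/g; ring.
Qed.

End PrimitiveDifferentials.

(** * Acoustic speeds as relativistic sums *)

Section Acoustics.
Context {R : realType}.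
Variables (e : R -> R) (V : 'rV[R]_4).
Hypothesis V_adm : admissible V.
Hypothesis de_gt0 : 0 < derive1 e (theta V).
Hypothesis h_gt : theta V * (1 + derive1 e (theta V)) / derive1 e (theta V)
  < enthalpy e (theta V).

Let v1 := vel1 V.
Let v2 := vel2 V.
Let r := rho V.
Let t := theta V.
Let a := derive1 e (theta V).
Let H := enthalpy e (theta V).
Let c := sound e V.
Let w := Num.sqrt (1 - v1 ^+ 2 - v2 ^+ 2).

Lemma enthalpy_gt0 : 0 < H.
Proof.
apply: lt_trans h_gt; have := theta_gt0 V_adm; have := de_gt0 => a0 t0.
by rewrite divr_gt0// mulr_gt0// addr_gt0.
Qed.

Lemma sound_sqr : c ^+ 2 = t * (1 + a) / (H * a).
Proof.
have [t0 H0 a0] : [/\ 0 < t, 0 < H & 0 < a].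
  by split => //; [exact: theta_gt0|exact: enthalpy_gt0].
by rewrite sqr_sqrtr// ltW// divr_gt0// mulr_gt0// addr_gt0.
Qed.

Lemma sound_gt0 : 0 < c.
Proof.
have [t0 H0 a0] : [/\ 0 < t, 0 < H & 0 < a].
  by split => //; [exact: theta_gt0|exact: enthalpy_gt0].
by rewrite sqrtr_gt0 divr_gt0// mulr_gt0// addr_gt0.
Qed.

(** Subluminality of sound is the hypothesis on the enthalpy. *)
Lemma sound_sqr_lt1 : c ^+ 2 < 1.
Proof.
have H0 := enthalpy_gt0; have a0 := de_gt0.
rewrite sound_sqr ltr_pdivrMr ?mulr_gt0// mul1r.
by rewrite -ltr_pdivrMr.
Qed.

Lemma lorentz_root_gt0 : 0 < w.
Proof. by rewrite sqrtr_gt0; exact: lorentz_arg_gt0. Qed.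

Lemma lorentz_root_sqr : w ^+ 2 = 1 - v1 ^+ 2 - v2 ^+ 2.
Proof. by rewrite sqr_sqrtr// ltW//; exact: lorentz_arg_gt0. Qed.

Lemma subr_vel1_sqr_gt0 : 0 < 1 - v1 ^+ 2.
Proof.
have := lorentz_arg_gt0 V_adm; rewrite -/v1 -/v2.
by have := sqr_ge0 v2; lra.
Qed.

Let s := Num.sqrt (1 - v1 ^+ 2 - v2 ^+ 2 * c ^+ 2).

Lemma sound_root_arg_gt0 : 0 < 1 - v1 ^+ 2 - v2 ^+ 2 * c ^+ 2.
Proof.
have := lorentz_arg_gt0 V_adm; rewrite -/v1 -/v2.
have := sound_sqr_lt1; have := sqr_ge0 v2; nra.
Qed.

Lemma sound_root_gt0 : 0 < s.
Proof. by rewrite sqrtr_gt0 sound_root_arg_gt0. Qed.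

Lemma sound_root_sqr : s ^+ 2 = 1 - v1 ^+ 2 - v2 ^+ 2 * c ^+ 2.
Proof. by rewrite sqr_sqrtr// ltW// sound_root_arg_gt0. Qed.

(** Speed along the first axis of the acoustic fronts in the frame that moves
    with velocity v1 along that axis. *)
Definition wave_speed : R := c * w / s.
Let k := wave_speed.

Lemma wave_speed_gt0 : 0 < k.
Proof.
by rewrite divr_gt0 ?mulr_gt0 ?sound_gt0 ?lorentz_root_gt0 ?sound_root_gt0.
Qed.

Lemma wave_speed_sqr_lt1 : k ^+ 2 < 1.
Proof.
rewrite /k /wave_speed exprMn exprVn exprMn.
rewrite ltr_pdivrMr ?exprn_gt0 ?sound_root_gt0//.
rewrite mul1r sound_root_sqr lorentz_root_sqr.
have := subr_vel1_sqr_gt0; have := sound_sqr_lt1; nra.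
Qed.

(** The form in which the equation of state enters the acoustic identities: as
    1 - v1^2 = s^2 + v2^2 c^2 with k s = c w, the factor w^2 + v2^2 k^2 is
    k^2 (1 - v1^2) / c^2. *)
Lemma wave_speed_eos :
  t * (1 + a) * (w ^+ 2 + v2 ^+ 2 * k ^+ 2) = H * a * k ^+ 2 * (1 - v1 ^+ 2).
Proof.
have H0 := enthalpy_gt0; have a0 := de_gt0; have s0 := sound_root_gt0.
have -> : t * (1 + a) = H * a * c ^+ 2.
  by rewrite sound_sqr; field; rewrite !gt_eqF.
have -> : 1 - v1 ^+ 2 = s ^+ 2 + v2 ^+ 2 * c ^+ 2.
  by rewrite sound_root_sqr; ring.
by rewrite /k /wave_speed; field; rewrite gt_eqF.
Qed.

Section Wave.
Variable kap : R.
Hypothesis kap_sqr : kap ^+ 2 = k ^+ 2.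

(** Positive since |v1| and |kap| are below 1; expanding (v1 + kap)^2 >= 0
    avoids absolute values. *)
Lemma wave_factor_gt0 : 0 < 1 + v1 * kap.
Proof.
have v1_lt1 := subr_vel1_sqr_gt0; have := wave_speed_sqr_lt1; rewrite -kap_sqr.
have := sqr_ge0 (v1 + kap); nra.
Qed.

(** For the relativistic sum lambda of v1 and kap, 1 - v1 lambda is
    (1 - v1^2) / (1 + v1 kap). *)
Lemma Delta_lambda_wave :
  Delta_lambda v1 ((v1 + kap) / (1 + v1 * kap)) = 1 + v1 * kap.
Proof.
have f0 : 1 + v1 * kap != 0 by rewrite gt_eqF// wave_factor_gt0.
have v0 : 1 - v1 ^+ 2 != 0 by rewrite gt_eqF// subr_vel1_sqr_gt0.
have E : 1 - v1 * ((v1 + kap) / (1 + v1 * kap))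
    = (1 - v1 ^+ 2) / (1 + v1 * kap) by field.
by rewrite /Delta_lambda E; field; rewrite v0 f0.
Qed.

End Wave.

(** With s + sg v1 c w = s (1 + sg v1 k), cross-multiplication leaves an
    identity modulo the two relations that define the squares of s and w. *)
Lemma acoustic1E (sg : R) : sg ^+ 2 = 1 ->
  acoustic1 e V sg = (v1 + sg * k) / (1 + v1 * (sg * k)).
Proof.
move=> sg2; have s0 := sound_root_gt0.
have f0 : 0 < 1 + v1 * (sg * k).
  by apply: wave_factor_gt0; rewrite exprMn sg2 mul1r.
have q0 : 0 < 1 - (v1 ^+ 2 + v2 ^+ 2) * c ^+ 2.
  have := lorentz_arg_gt0 V_adm; rewrite -/v1 -/v2.
  have := sound_sqr_lt1; have := sqr_ge0 c; nra.
rewrite /acoustic1 -/v1 -/v2 -/c sqrtrM ?ltW ?lorentz_arg_gt0// -/w -/s.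
have g0 : 0 < s + v1 * (sg * (c * w)).
  rewrite (_ : s + _ = (1 + v1 * (sg * k)) * s); first by rewrite mulr_gt0.
  by rewrite /k /wave_speed; field; rewrite gt_eqF.
rewrite /k /wave_speed; have Hw := lorentz_root_sqr.
have Hs := sound_root_sqr.
by field: sg2 Hs Hw; rewrite !gt_eqF.
Qed.

(** Factors the difference in the definition of M_1, by [wave_speed_eos]. *)
Lemma M1E : M1 e V = r * t * w / (H * k ^+ 2 * (1 - v1 ^+ 2)).
Proof.
have [t0 H0 a0] : [/\ 0 < t, 0 < H & 0 < a].
  by split => //; [exact: theta_gt0|exact: enthalpy_gt0].
have v0 := subr_vel1_sqr_gt0; have k0 := wave_speed_gt0.
have w0 := lorentz_root_gt0.
have a1 : 0 < 1 + a by rewrite addr_gt0.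
have -> : M1 e V = r / w * (a / (1 + a) - t * v2 ^+ 2 / (H * (1 - v1 ^+ 2))).
  by [].
have -> : a / (1 + a) =
    t * (w ^+ 2 + v2 ^+ 2 * k ^+ 2) / (H * k ^+ 2 * (1 - v1 ^+ 2)).
  have a1' : 1 + a != 0 by rewrite gt_eqF.
  have D0 : H * k ^+ 2 * (1 - v1 ^+ 2) != 0.
    by rewrite gt_eqF// mulr_gt0// mulr_gt0// exprn_gt0.
  apply/eqP; rewrite eqr_div//.
  by apply/eqP; rewrite [RHS]mulrAC wave_speed_eos; ring.
by field; rewrite !gt_eqF.
Qed.

Lemma N1E : N1 e V = M1 e V * (v1 * k).
Proof.
have H0 := enthalpy_gt0; have c0 := sound_gt0; have s0 := sound_root_gt0.
have v0 := subr_vel1_sqr_gt0; have w0 := lorentz_root_gt0.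
have k0 := wave_speed_gt0.
have -> : N1 e V = r * t * v1 * s / (H * c * (1 - v1 ^+ 2)) by [].
rewrite M1E (_ : s = c * w / k); last first.
  by rewrite /k /wave_speed; field; rewrite !gt_eqF.
by field; rewrite !gt_eqF.
Qed.

End Acoustics.

(** * Eigendirections and their pairings *)

Definition dot (R : realType) (x y : 'rV[R]_4) : R := (x *m y^T) 0 0.

Lemma dotE (R : realType) (x y : 'rV[R]_4) :
  dot x y = x 0 0 * y 0 0 + x 0 1 * y 0 1 + x 0 2 * y 0 2 + x 0 3 * y 0 3.
Proof.
rewrite /dot (row4_eta x) (row4_eta y) mxE !row4E.
by rewrite !big_ord_recl big_ord0 !mxE /= addr0 !addrA.
Qed.

Section Eigenvectors.
Context {R : realType}.
Variables (e : R -> R) (V : 'rV[R]_4).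
Hypothesis V_adm : admissible V.
Hypothesis de_gt0 : 0 < derive1 e (theta V).
Hypothesis h_gt : theta V * (1 + derive1 e (theta V)) / derive1 e (theta V)
  < enthalpy e (theta V).

Let v1 := vel1 V.
Let v2 := vel2 V.
Let r := rho V.
Let t := theta V.
Let a := derive1 e (theta V).
Let H := enthalpy e (theta V).
Let g := lorentz V.
Let k := wave_speed e V.
Let w := Num.sqrt (1 - v1 ^+ 2 - v2 ^+ 2).

(** Perturbations of (rho, v1, v2, p), normalized so that their images under dU
    are the unscaled columns of [R1]. *)
Definition entropy_dir : 'rV[R]_4 := row4 (g ^- 2) 0 0 0.
Definition shear_dir : 'rV[R]_4 := row4 0 0 (r * g ^+ 2)^-1 0.

(** Obtained by solving dF_1 = lambda dU with dD = 1: mass conservation gives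
    dv1 = (lambda - v1) / D, transverse momentum conservation gives
    d(h gamma v2) = 0, longitudinal momentum and energy conservation give dp and
    d(h gamma), hence dv2, and finally dp = h c^2 drho because the entropy is
    constant along the wave. *)
Definition acoustic_dir (kap : R) : 'rV[R]_4 :=
  (1 + v1 * kap)^-1 *:
  row4 (g * (g ^- 2 + v2 ^+ 2 * kap ^+ 2))
       (kap * (1 - v1 ^+ 2) / (r * g))
       (- (v2 * kap * (v1 + kap) / (r * g)))
       (H * g * kap ^+ 2 * (1 - v1 ^+ 2)).

(** The columns of [R1], unscaled; in the acoustic one, v1 + kap stands for
    Delta_lambda lambda and 1 + v1 kap for Delta_lambda. *)
Definition entropy_vec : 'rV[R]_4 :=
  let D := Delta_theta e V in row4 g^-1 (D * v1) (D * v2) D.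
Definition shear_vec : 'rV[R]_4 :=
  row4 (g * v2) (2 * H * g ^+ 2 * v1 * v2) (H * (1 + 2 * g ^+ 2 * v2 ^+ 2))
       (2 * H * g ^+ 2 * v2).
Definition acoustic_vec (kap : R) : 'rV[R]_4 :=
  row4 1 (H * g * (v1 + kap)) (H * g * v2) (H * g * (1 + v1 * kap)).

Let gE : g = w^-1. Proof. by []. Qed.
Let w0 : w != 0. Proof. by rewrite gt_eqF// lorentz_root_gt0. Qed.
Let w2 : w ^+ 2 = 1 - v1 ^+ 2 - v2 ^+ 2. Proof. exact: lorentz_root_sqr. Qed.
Let r0 : r != 0. Proof. by case: V_adm => /gt_eqF/negbT. Qed.
Let t0 : t != 0. Proof. by rewrite gt_eqF// theta_gt0. Qed.
Let H0 : H != 0. Proof. by rewrite gt_eqF//; exact: enthalpy_gt0. Qed.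

(** Reduces an identity between components to a rational identity in which
    gamma appears as the inverse of w, so that [field] can use w^2. *)
Ltac unfold_components :=
  rewrite /entropy_dir /shear_dir /acoustic_dir /entropy_vec /shear_vec
    /acoustic_vec /dconsU /denth /dfluxF1 /dentropyW /dlorentz /dtheta
    /Delta_theta /consU /rho /vel1 /vel2 /pres ?row4E ?mxE /=;
  rewrite -?/(rho V) -?/(vel1 V) -?/(vel2 V) -?/r -?/v1 -?/v2 -?/t -?/a -?/H
    -?/g ?gE.

Lemma dconsU_entropy : dconsU V e entropy_dir = entropy_vec.
Proof.
apply/rowP => -[[|[|[|[|//]]]] lt_j4]; unfold_components.
- by field.
- by field.
- by field.
- by field.
Qed.

Lemma dconsU_shear : dconsU V e shear_dir = shear_vec.
Proof.
apply/rowP => -[[|[|[|[|//]]]] lt_j4]; unfold_components.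
- by field: w2; rewrite r0 w0.
- by field: w2; rewrite r0 w0.
- by field: w2; rewrite r0 w0.
- by field: w2; rewrite r0 w0.
Qed.

Lemma dfluxF1_entropy : dfluxF1 V e entropy_dir = v1 *: entropy_vec.
Proof.
rewrite /dfluxF1 dconsU_entropy.
by apply/rowP => -[[|[|[|[|//]]]] lt_j4]; unfold_components; ring.
Qed.

Lemma dfluxF1_shear : dfluxF1 V e shear_dir = v1 *: shear_vec.
Proof.
rewrite /dfluxF1 dconsU_shear.
by apply/rowP => -[[|[|[|[|//]]]] lt_j4]; unfold_components; ring.
Qed.

Section Wave.
Variable kap : R.
Hypothesis kap_sqr : kap ^+ 2 = k ^+ 2.

Let f0 : 1 + v1 * kap != 0.
Proof. by rewrite gt_eqF//; exact: (wave_factor_gt0 V_adm de_gt0 h_gt). Qed.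
Let b0 : w ^+ 2 + (v2 * kap) ^+ 2 != 0.
Proof.
have w_pos : 0 < w by exact: lorentz_root_gt0.
by rewrite gt_eqF// ltr_pwDl ?exprn_gt0 ?sqr_ge0.
Qed.
Let a1 : 1 + a != 0.
Proof. by rewrite gt_eqF// addr_gt0. Qed.
(** The equation of state solved for theta, which eliminates it from rational
    identities. *)
Let tE : t = H * a * kap ^+ 2 * (1 - v1 ^+ 2)
  / ((1 + a) * (w ^+ 2 + v2 ^+ 2 * kap ^+ 2)).
Proof.
have : t * (1 + a) * (w ^+ 2 + v2 ^+ 2 * kap ^+ 2)
    = H * a * kap ^+ 2 * (1 - v1 ^+ 2).
  by rewrite kap_sqr; exact: wave_speed_eos.
by move=> <-; field; rewrite a1 b0.
Qed.

Lemma dconsU_acoustic : dconsU V e (acoustic_dir kap) = acoustic_vec kap.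
Proof.
apply/rowP => -[[|[|[|[|//]]]] lt_j4]; unfold_components; rewrite ?tE.
- by field: w2; rewrite f0 w0.
- by field: w2; rewrite ?f0 ?w0 ?r0 ?a1 ?b0.
- by field: w2; rewrite ?f0 ?w0 ?r0 ?a1 ?b0.
- by field: w2; rewrite ?f0 ?w0 ?r0 ?a1 ?b0.
Qed.

Lemma dfluxF1_acoustic :
  dfluxF1 V e (acoustic_dir kap) =
  ((v1 + kap) / (1 + v1 * kap)) *: acoustic_vec kap.
Proof.
rewrite /dfluxF1 dconsU_acoustic.
apply/rowP => -[[|[|[|[|//]]]] lt_j4]; unfold_components.
- by field; rewrite ?f0 ?w0 ?r0.
- by field: w2; rewrite ?f0 ?w0 ?r0.
- by field: w2; rewrite ?f0 ?w0 ?r0.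
- by field: w2; rewrite ?f0 ?w0 ?r0.
Qed.

(** Twice the inverse of M_1 (1 + v1 kap), by [M1E]. *)
Lemma dot_acoustic_acoustic :
  dot (acoustic_vec kap) (dentropyW V e (acoustic_dir kap)) =
  2 * H * kap ^+ 2 * (1 - v1 ^+ 2) / (r * t * w * (1 + v1 * kap)).
Proof.
rewrite dotE; unfold_components.
by field: w2; rewrite ?f0 ?w0 ?r0 ?t0.
Qed.

Lemma dot_acoustic_opposite :
  dot (acoustic_vec (- kap)) (dentropyW V e (acoustic_dir kap)) = 0.
Proof.
rewrite dotE; unfold_components.
by field: w2; rewrite ?f0 ?w0 ?r0 ?t0.
Qed.

(** The only pairing that vanishes because of the equation of state: it
    expresses that the acoustic waves are isentropic. *)
Lemma dot_entropy_acoustic :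
  dot entropy_vec (dentropyW V e (acoustic_dir kap)) = 0.
Proof.
have a0 : a != 0 by rewrite gt_eqF.
have u0 : 1 - v1 ^+ 2 != 0 by rewrite gt_eqF//; exact: subr_vel1_sqr_gt0.
have kap0 : kap != 0.
  by rewrite -sqrf_eq0 kap_sqr sqrf_eq0 gt_eqF//; exact: wave_speed_gt0.
rewrite dotE; unfold_components; rewrite tE.
by field: w2; rewrite w0 r0 f0 b0 a1 u0 kap0 a0 H0.
Qed.

Lemma dot_shear_acoustic :
  dot shear_vec (dentropyW V e (acoustic_dir kap)) = 0.
Proof.
rewrite dotE; unfold_components.
by field: w2; rewrite ?f0 ?w0 ?r0 ?t0.
Qed.

Lemma dot_acoustic_entropy :
  dot (acoustic_vec kap) (dentropyW V e entropy_dir) = 0.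
Proof.
rewrite dotE; unfold_components.
by field: w2; rewrite ?f0 ?w0 ?r0 ?t0.
Qed.

Lemma dot_acoustic_shear :
  dot (acoustic_vec kap) (dentropyW V e shear_dir) = 0.
Proof.
rewrite dotE; unfold_components.
by field: w2; rewrite ?f0 ?w0 ?r0 ?t0.
Qed.

End Wave.

Lemma dot_entropy_entropy :
  dot entropy_vec (dentropyW V e entropy_dir) = (1 + a) / (r * g ^+ 3).
Proof.
rewrite dotE; unfold_components.
by field: w2; rewrite ?w0 ?r0 ?t0.
Qed.

Lemma dot_shear_shear :
  dot shear_vec (dentropyW V e shear_dir) = H * (1 - v1 ^+ 2) * g / (r * t).
Proof.
rewrite dotE; unfold_components.
by field: w2; rewrite ?w0 ?r0 ?t0.
Qed.

Lemma dot_entropy_shear :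
  dot entropy_vec (dentropyW V e shear_dir) = 0.
Proof.
rewrite dotE; unfold_components.
by field: w2; rewrite ?w0 ?r0 ?t0.
Qed.

Lemma dot_shear_entropy :
  dot shear_vec (dentropyW V e entropy_dir) = 0.
Proof.
rewrite dotE; unfold_components.
by field: w2; rewrite ?w0 ?r0 ?t0.
Qed.

End Eigenvectors.

(** * Diagonalization in the first direction *)

(** The columns of Q are eigenvectors of J A^-1, and Y = A^-1 Q. The third
    hypothesis says that Q^T is inverse to W Y, which replaces any computation
    of determinants or inverses. *)
Lemma symmetrized_diagonalization (F : fieldType) n (A J W Q Y L : 'M[F]_n) :
    A *m Y = Q -> J *m Y = Q *m L -> Q^T *m (W *m Y) = 1%:M ->
  [/\ A \in unitmx, W \in unitmx & Q \in unitmx] /\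
  J *m invmx A = Q *m L *m invmx Q /\ A *m invmx W = Q *m Q^T.
Proof.
move=> AY JY QWY.
have [uQt] := mulmx1_unit QWY; rewrite unitmx_mul => /andP[uW uY].
have uQ : Q \in unitmx by rewrite -unitmx_tr.
have uA : A \in unitmx by move: uQ; rewrite -AY unitmx_mul => /andP[].
split=> //; split.
  have -> : invmx A = Y *m invmx Q by rewrite -[Y in RHS](mulKmx uA) AY mulmxK.
  by rewrite mulmxA JY.
have -> : invmx W = Y *m Q^T.
  by rewrite -[RHS](mulKmx uW) (mulmxA W) (mulmx1C QWY) mulmx1.
by rewrite mulmxA AY.
Qed.

Lemma mulmx_trE (R : realType) m n (A : 'M[R]_(m, 4)) (B : 'M[R]_(n, 4)) i j :
  (A *m B^T) i j = dot (row i A) (row j B).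
Proof. by rewrite /dot !mxE; apply: eq_bigr => l _; rewrite !mxE. Qed.

Lemma diag_sqrt_normalize (R : realType) n (d : 'rV[R]_n) :
  (forall j, 0 < d 0 j) ->
  diag_mx (map_mx Num.sqrt d) *m diag_mx (map_mx GRing.inv d)
    *m diag_mx (map_mx Num.sqrt d) = 1%:M.
Proof.
move=> d_gt0; apply/matrixP => i j; rewrite mul_mx_diag mxE mul_diag_mx !mxE.
have [->|neq_ij] := eqVneq i j; last by rewrite mulr0 mul0r.
rewrite mulr1n mulrAC; apply: (canLR (mulfK _)); first by rewrite gt_eqF.
by rewrite mul1r -expr2 sqr_sqrtr// ltW.
Qed.

Section FirstDirection.
Context {R : realType}.
Variables (e Z : R -> R) (V : 'rV[R]_4).
Hypothesis V_adm : admissible V.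
Hypothesis e_derivable : derivable e (theta V) 1.
Hypothesis Z_derive : is_derive (theta V) 1 Z (derive1 e (theta V) / theta V).
Hypothesis de_gt0 : 0 < derive1 e (theta V).
Hypothesis h_gt : theta V * (1 + derive1 e (theta V)) / derive1 e (theta V)
  < enthalpy e (theta V).

Let k := wave_speed e V.
Let Nk_sqr : (- k) ^+ 2 = k ^+ 2. Proof. exact: sqrrN. Qed.

Definition eigenvecs : 'M[R]_4 := \matrix_(i < 4)
  [:: acoustic_vec e V (- k); entropy_vec e V; shear_vec e V;
      acoustic_vec e V k]`_i.

Definition eigendirs : 'M[R]_4 := \matrix_(i < 4)
  [:: acoustic_dir e V (- k); entropy_dir V; shear_dir V;
      acoustic_dir e V k]`_i.

Let lam : 'rV[R]_4 := row4 ((vel1 V - k) / (1 + vel1 V * - k)) (vel1 V)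
  (vel1 V) ((vel1 V + k) / (1 + vel1 V * k)).

Lemma Lambda1E : Lambda1 e V = diag_mx lam.
Proof.
rewrite /Lambda1 !(acoustic1E V_adm de_gt0 h_gt) ?sqrrN ?expr1n//.
by rewrite -/k mulN1r mul1r.
Qed.

Lemma acoustic_weight (kap : R) : kap ^+ 2 = k ^+ 2 ->
  M1 e V * (1 + vel1 V * kap) / 2 =
  (2 * enthalpy e (theta V) * kap ^+ 2 * (1 - vel1 V ^+ 2) /
    (rho V * theta V * Num.sqrt (1 - vel1 V ^+ 2 - vel2 V ^+ 2)
     * (1 + vel1 V * kap)))^-1
  /\ 0 < M1 e V * (1 + vel1 V * kap) / 2.
Proof.
move=> kap2; rewrite (M1E V_adm de_gt0 h_gt) -/k -kap2.
have [r0 _ _] := V_adm; have t0 := theta_gt0 V_adm.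
have H0 := enthalpy_gt0 V_adm de_gt0 h_gt; have w0 := lorentz_root_gt0 V_adm.
have u0 := subr_vel1_sqr_gt0 V_adm.
have f0 := wave_factor_gt0 V_adm de_gt0 h_gt kap2.
have kap0 : 0 < kap ^+ 2.
  by rewrite kap2 exprn_gt0//; exact: wave_speed_gt0.
have kap1 : kap != 0 by rewrite -sqrf_eq0 gt_eqF.
split; first by field; rewrite kap1 !gt_eqF.
by do !(done || (apply: divr_gt0 || apply: mulr_gt0)).
Qed.

(** The weights d_1 are exactly what normalizes the pairing. *)
Lemma pairing_diag (j : 'I_4) : d1 e V 0 j > 0 /\
  dot (row j eigenvecs) (dentropyW V e (row j eigendirs)) = (d1 e V 0 j)^-1.
Proof.
have [r0 _ _] := V_adm; have t0 := theta_gt0 V_adm.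
have H0 := enthalpy_gt0 V_adm de_gt0 h_gt.
have u0 := subr_vel1_sqr_gt0 V_adm.
have g0 : 0 < lorentz V by rewrite invr_gt0; exact: lorentz_root_gt0.
have a1 : 0 < 1 + derive1 e (theta V) by rewrite addr_gt0.
rewrite !rowK; case: j => -[|[|[|[|//]]]] lt_j4; rewrite mxE /=.
- rewrite (N1E V_adm de_gt0 h_gt) -/k.
  have -> : (M1 e V - M1 e V * (vel1 V * k)) / 2
    = M1 e V * (1 + vel1 V * (- k)) / 2 by ring.
  have [E pos] := acoustic_weight Nk_sqr; split=> //.
  by rewrite E invrK (dot_acoustic_acoustic V_adm de_gt0 h_gt).
- split; first by rewrite divr_gt0// mulr_gt0// exprn_gt0.
  by rewrite (dot_entropy_entropy e V_adm) invf_div.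
- split.
    apply: divr_gt0; first exact: mulr_gt0.
    by apply: mulr_gt0 => //; exact: mulr_gt0.
  by rewrite (dot_shear_shear e V_adm) invf_div.
- rewrite (N1E V_adm de_gt0 h_gt) -/k.
  have -> : (M1 e V + M1 e V * (vel1 V * k)) / 2
    = M1 e V * (1 + vel1 V * k) / 2 by ring.
  have [E pos] := acoustic_weight erefl; split=> //.
  by rewrite E invrK (dot_acoustic_acoustic V_adm de_gt0 h_gt).
Qed.

Lemma pairing_off_diag (i j : 'I_4) : i != j ->
  dot (row i eigenvecs) (dentropyW V e (row j eigendirs)) = 0.
Proof.
have opp :
    dot (acoustic_vec e V k) (dentropyW V e (acoustic_dir e V (- k))) = 0.
  by rewrite -[X in acoustic_vec _ _ X]opprK dot_acoustic_opposite.
rewrite !rowK.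
by case: i => -[|[|[|[|//]]]] lt_i4; case: j => -[|[|[|[|//]]]] lt_j4;
  rewrite // => _ /=;
  rewrite ?opp ?dot_acoustic_opposite ?dot_acoustic_entropy
    ?dot_acoustic_shear ?dot_entropy_acoustic ?dot_shear_acoustic
    ?dot_entropy_shear ?dot_shear_entropy.
Qed.

Let sd := map_mx Num.sqrt (d1 e V).

Lemma R1E : R1 e V = eigenvecs^T *m diag_mx sd.
Proof.
rewrite /R1 !(acoustic1E V_adm de_gt0 h_gt) ?sqrrN ?expr1n//.
rewrite -/k mulN1r mul1r.
rewrite (Delta_lambda_wave V_adm de_gt0 h_gt Nk_sqr).
rewrite (Delta_lambda_wave V_adm de_gt0 h_gt (erefl (k ^+ 2))).
have fm := wave_factor_gt0 V_adm de_gt0 h_gt Nk_sqr.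
have fp := wave_factor_gt0 V_adm de_gt0 h_gt (erefl (k ^+ 2)).
congr (_ *m _); apply/matrixP => i j; rewrite !mxE.
case: i => -[|[|[|[|//]]]] lt_i4; case: j => -[|[|[|[|//]]]] lt_j4;
  rewrite /= !mxE //=.
- by field; rewrite gt_eqF.
- by field; rewrite gt_eqF.
Qed.

Lemma first_direction :
  [/\ jac (consU e) V \in unitmx, jac (entropyW e Z) V \in unitmx
    & R1 e V \in unitmx] /\
  dF1dU e V = R1 e V *m Lambda1 e V *m invmx (R1 e V) /\
  dUdW e Z V = R1 e V *m (R1 e V)^T.
Proof.
have dU := is_diff_consU V_adm e_derivable.
have dF := is_diff_fluxF1 V_adm e_derivable.
have dW := is_diff_entropyW V_adm e_derivable Z_derive.
apply: (symmetrized_diagonalization (Y := eigendirs^T *m diag_mx sd)).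
- rewrite R1E mulmxA; congr (_ *m _); apply/trmx_inj.
  rewrite trmx_mul [X in X *m _]trmxK (mul_tr_jac _ dU) trmxK.
  apply/row_matrixP => i; rewrite !rowK.
  by case: i => -[|[|[|[|//]]]] lt_i4 /=;
    rewrite ?dconsU_acoustic ?dconsU_entropy ?dconsU_shear.
- rewrite R1E Lambda1E -mulmxA diag_mxC !mulmxA; congr (_ *m _).
  apply/trmx_inj; rewrite !trmx_mul [X in X *m _]trmxK (mul_tr_jac _ dF).
  rewrite tr_diag_mx trmxK; apply/row_matrixP => i.
  rewrite [in RHS]row_mul row_diag_mx -scalemxAl -rowE !rowK mxE.
  by case: i => -[|[|[|[|//]]]] lt_i4 /=;
    rewrite ?dfluxF1_acoustic ?dfluxF1_entropy ?dfluxF1_shear.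
- rewrite R1E trmx_mul trmxK tr_diag_mx !mulmxA.
  rewrite -(mulmxA _ _ eigendirs^T) -(mulmxA _ eigenvecs).
  rewrite -[jac _ _]trmxK -trmx_mul (mul_tr_jac _ dW).
  have -> : eigenvecs *m (\matrix_i dentropyW V e (row i eigendirs))^T =
      diag_mx (map_mx GRing.inv (d1 e V)).
    apply/matrixP => i j; rewrite mulmx_trE rowK [RHS]mxE [X in X *+ _]mxE.
    have [->|neq_ij] := eqVneq i j; last by rewrite pairing_off_diag.
    by have [_ ->] := pairing_diag j; rewrite mulr1n.
  by apply: diag_sqrt_normalize => j; have [] := pairing_diag j.
Qed.

End FirstDirection.

(** * The second direction by exchange of the axes *)

Section Swap.
Context {R : realType}.
Variables (e Z : R -> R) (V : 'rV[R]_4).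

Let P := swapM R.

Lemma swap_conjE (A : 'M[R]_4) i j :
  (P *m A *m P) i j = A (tperm 1 2 i) (tperm 1 2 j).
Proof. by rewrite /P /swapM -xcolE -xrowE !mxE. Qed.

Lemma swap_conjM (A B : 'M[R]_4) :
  P *m (A *m B) *m P = (P *m A *m P) *m (P *m B *m P).
Proof.
by rewrite !mulmxA -(mulmxA (P *m A) P P) swapM_invol mulmx1.
Qed.

Lemma swapM_unit : P \in unitmx.
Proof. exact: unitmx_perm. Qed.

Lemma swap_conj_unit (A : 'M[R]_4) : (P *m A *m P \in unitmx) = (A \in unitmx).
Proof. by rewrite !unitmx_mul swapM_unit andbT. Qed.

Lemma swap_conjV (A : 'M[R]_4) : A \in unitmx ->
  invmx (P *m A *m P) = P *m invmx A *m P.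
Proof.
move=> uA; have uPAP : P *m A *m P \in unitmx by rewrite swap_conj_unit.
by rewrite -[RHS](mulKmx uPAP) -swap_conjM mulmxV// mulmx1 swapM_invol mulmx1.
Qed.

Lemma swap_conjT (A : 'M[R]_4) : (P *m A *m P)^T = P *m A^T *m P.
Proof. by rewrite !trmx_mul tr_swapM mulmxA. Qed.

Lemma vel1_swap (W : 'rV[R]_4) : vel1 (swap W) = vel2 W.
Proof. by rewrite /vel1 row4E. Qed.

Lemma vel2_swap (W : 'rV[R]_4) : vel2 (swap W) = vel1 W.
Proof. by rewrite /vel2 row4E. Qed.

Lemma rho_swap (W : 'rV[R]_4) : rho (swap W) = rho W.
Proof. by rewrite /rho row4E. Qed.

Lemma pres_swap (W : 'rV[R]_4) : pres (swap W) = pres W.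
Proof. by rewrite /pres row4E. Qed.

Lemma theta_swap (W : 'rV[R]_4) : theta (swap W) = theta W.
Proof. by rewrite /theta rho_swap pres_swap. Qed.

Lemma lorentz_swap (W : 'rV[R]_4) : lorentz (swap W) = lorentz W.
Proof. by rewrite /lorentz vel1_swap vel2_swap addrAC. Qed.

Lemma sound_swap (W : 'rV[R]_4) : sound e (swap W) = sound e W.
Proof. by rewrite /sound theta_swap. Qed.

Definition swapFE := (vel1_swap, vel2_swap, rho_swap, pres_swap, theta_swap,
  lorentz_swap, sound_swap).

Lemma admissible_swap : admissible V -> admissible (swap V).
Proof. by rewrite /admissible !swapFE [vel2 V ^+ 2 + _]addrC. Qed.

Lemma consU_swap (W : 'rV[R]_4) : consU e W = swap (consU e (swap W)).
Proof. by rewrite /consU !swapFE /swap !row4E. Qed.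

Lemma fluxF2_swap (W : 'rV[R]_4) : fluxF2 e W = swap (fluxF1 e (swap W)).
Proof. by rewrite /fluxF2 /fluxF1 /consU !swapFE /swap !row4E. Qed.

Lemma entropyW_swap (W : 'rV[R]_4) :
  entropyW e Z W = swap (entropyW e Z (swap W)).
Proof.
rewrite /entropyW /entropyS !swapFE /swap.
by apply/rowP => -[[|[|[|[|//]]]] lt_j4]; rewrite !mxE.
Qed.

Lemma acoustic2_swap (s : R) : acoustic2 e V s = acoustic1 e (swap V) s.
Proof.
rewrite /acoustic2 /acoustic1 !swapFE [vel2 V ^+ 2 + vel1 V ^+ 2]addrC.
by rewrite [1 - vel2 V ^+ 2 - vel1 V ^+ 2]addrAC.
Qed.

Lemma Lambda2_swap : Lambda2 e V = P *m Lambda1 e (swap V) *m P.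
Proof.
apply/matrixP => i j; rewrite swap_conjE /Lambda2 /Lambda1 !acoustic2_swap.
rewrite vel1_swap !mxE (inj_eq perm_inj); congr (_ *+ _).
by case: i => -[|[|[|[|//]]]] lt_i4; rewrite permE.
Qed.

Lemma d2_swap : d2 e V = d1 e (swap V) *m P.
Proof.
rewrite -swapE /d2 /d1 /M1 /M2 /N1 /N2 /swap !row4E.
by rewrite -/(swap V) !swapFE.
Qed.

Lemma R2_swap : R2 e V = P *m R1 e (swap V) *m P.
Proof.
rewrite /R1 swap_conjM; congr (_ *m _).
  rewrite /Delta_theta !acoustic2_swap !swapFE.
  apply/matrixP => i j; rewrite swap_conjE !mxE.
  case: i => -[|[|[|[|//]]]] lt_i4; case: j => -[|[|[|[|//]]]] lt_j4;
    rewrite !permE //=.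
  by ring.
apply/matrixP => i j; rewrite swap_conjE d2_swap -swapE.
rewrite [LHS]mxE [RHS]mxE (inj_eq perm_inj); congr (_ *+ _).
rewrite !mxE; case: i => -[|[|[|[|//]]]] lt_i4;
  by rewrite permE /= ?row4E.
Qed.

Lemma dUdW_swap :
  differentiable (consU e) (swap V) -> differentiable (entropyW e Z) (swap V) ->
  jac (entropyW e Z) (swap V) \in unitmx ->
  dUdW e Z V = P *m dUdW e Z (swap V) *m P.
Proof.
move=> dU dW uW; rewrite /dUdW (jac_swap consU_swap dU).
by rewrite (jac_swap entropyW_swap dW) swap_conjV// swap_conjM.
Qed.

Lemma dF2dU_swap :
  differentiable (consU e) (swap V) -> differentiable (fluxF1 e) (swap V) ->
  jac (consU e) (swap V) \in unitmx ->
  dF2dU e V = P *m dF1dU e (swap V) *m P.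
Proof.
move=> dU dF uU; rewrite /dF2dU /dF1dU (jac_swap consU_swap dU).
by rewrite (jac_swap fluxF2_swap dF) swap_conjV// swap_conjM.
Qed.

End Swap.

Theorem theorem9 (R : realType) (e Z : R -> R)
  (e_derivable : forall x : R, 0 < x -> derivable e x 1)
  (e_C1 : forall x : R, 0 < x -> {for x, continuous (derive1 e)})
  (de_gt0 : forall x : R, 0 < x -> 0 < derive1 e x)
  (h_gt : forall x : R, 0 < x ->
    enthalpy e x > x * (1 + derive1 e x) / derive1 e x)
  (Z_antiderivative : forall x : R, 0 < x -> is_derive x 1 Z (derive1 e x / x))
  (V : 'rV[R]_4) (V_admissible : admissible V) :
  (* the inverses occurring below are genuine *)
  [/\ jac (consU e) V \in unitmx, jac (entropyW e Z) V \in unitmx,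
      R1 e V \in unitmx & R2 e V \in unitmx] /\
  (dF1dU e V = R1 e V *m Lambda1 e V *m invmx (R1 e V) /\
   dUdW e Z V = R1 e V *m (R1 e V)^T) /\
  (dF2dU e V = R2 e V *m Lambda2 e V *m invmx (R2 e V) /\
   dUdW e Z V = R2 e V *m (R2 e V)^T).
Proof.
have tV_gt0 := theta_gt0 V_admissible.
have [[uU uW uR1] [F1E U1E]] := first_direction V_admissible
  (e_derivable _ tV_gt0) (Z_antiderivative _ tV_gt0) (de_gt0 _ tV_gt0)
  (h_gt _ tV_gt0).
have V'_adm := admissible_swap V_admissible.
have t_gt0 := theta_gt0 V'_adm.
have de := e_derivable _ t_gt0; have dZ := Z_antiderivative _ t_gt0.
have [[uU' uW' uR1'] [F2E U2E]] := first_direction V'_adm de dZ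
  (de_gt0 _ t_gt0) (h_gt _ t_gt0).
have dU : differentiable (consU e) (swap V).
  by have [] := is_diff_consU V'_adm de.
have dF : differentiable (fluxF1 e) (swap V).
  by have [] := is_diff_fluxF1 V'_adm de.
have dW : differentiable (entropyW e Z) (swap V).
  by have [] := is_diff_entropyW V'_adm de dZ.
split; first by split=> //; rewrite R2_swap swap_conj_unit.
split=> //; rewrite dF2dU_swap// dUdW_swap// R2_swap Lambda2_swap.
by rewrite swap_conjV// swap_conjT F2E U2E !swap_conjM.
Qed.
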